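(* Let $f_e:\mathbb{R}^d\to\mathbb{R}^m$ be a (measurable) feature encoder with $\|f_e(\bm u)\|_2=1$ for all $\bm u$, with smoothed version $\hat f_e(\bm u)=\mathbb{E}_{\bm\varepsilon\sim\mathcal N(0,I)}[f_e(\bm u+\bm\varepsilon)]$ and Gaussian robustness score $\hat S$. Let $K\ge2$ and let $\bm t_1,\dots,\bm t_K\in\mathbb{R}^m$ be unit vectors (candidate text embeddings). Let $\bm x\in\mathbb{R}^d$, $\bm z=f_e(\bm x)$, and assume that $y=\arg\max_{k}\bm z^\top\bm t_k$ is unique. For $k\ne y$ put $$\gamma_{y,k}=\sqrt{1-\frac{(\bm z^\top\bm t_y-\bm z^\top\bm t_k)^2}{2(1-\bm t_y^\top\bm t_k)}},\qquad \gamma^*_{\mathrm{top1}}=\max_{k\neq y}\gamma_{y,k},$$ and $$\mathcal R_{\mathrm{ret}}=\Phi^{-1}\big(\hat S(\bm x)\big)-\Phi^{-1}\Big(\frac{1+\gamma^*_{\mathrm{top1}}}{2}\Big).$$ Then for every $\bm x'\in\mathbb{R}^d$ with $\|\bm x'-\bm x\|_2<\mathcal R_{\mathrm{ret}}$, the $\ell_2$-normalized smoothed feature $\hat{\bm z}'=\hat f_e(\bm x')/\|\hat f_e(\bm x')\|_2$ satisfies $\arg\max_{k}\hat{\bm z}'^\top\bm t_k=y$.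
   Context: $\mathcal N(0,I)$ is the standard Gaussian on $\mathbb{R}^d$. $\mathrm{Cos}(\bm u,\bm v)=\frac{\bm u^\top\bm v}{\|\bm u\|_2\|\bm v\|_2}$. The Gaussian robustness score is $\hat S(\bm x)=\tfrac12\big(1+\mathbb{E}_{\bm\varepsilon\sim\mathcal N(0,I)}[\mathrm{Cos}(f_e(\bm x+\bm\varepsilon),f_e(\bm x))]\big)\in[0,1]$. $\Phi$ is the standard Gaussian cumulative distribution function and $\Phi^{-1}$ its inverse, with $\Phi^{-1}(0)=-\infty$, $\Phi^{-1}(1)=+\infty$. (Uniqueness of $y$ ensures $\bm t_k\neq\bm t_y$ for $k\ne y$, so $\gamma_{y,k}$ is well defined and less than 1.) *)

(* Defs.v *)
From HB Require Import structures.
From mathcomp Require Import all_boot all_order all_algebra.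
From mathcomp Require Import all_classical all_reals all_analysis.

Set Implicit Arguments.
Unset Strict Implicit.
Unset Printing Implicit Defensive.
Import Order.TTheory GRing.Theory Num.Theory.
Import numFieldNormedType.Exports.

Local Open Scope classical_set_scope.
Local Open Scope ring_scope.

Definition measure_matrix_display : measure_display -> measure_display.
Proof. exact. Qed.

Section measurable_matrix.
Context {d : measure_display} {T : measurableType d}.
Variables m n : nat.

(* The product sigma-algebra, generated by the entries; on 'rV[R]_n with R the
   reals it is the Borel sigma-algebra. *)
Definition g_sigma_entries : set (set 'M[T]_(m, n)) :=
  <<s \bigcup_(ij in [set: 'I_m * 'I_n])
        preimage_set_system setT (fun A : 'M[T]_(m, n) => A ij.1 ij.2)
          measurable >>.

Let entries_set0 : g_sigma_entries set0.
Proof. exact: sigma_algebra0. Qed.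

Let entries_setC A : g_sigma_entries A -> g_sigma_entries (~` A).
Proof. exact: sigma_algebraC. Qed.

Let entries_bigcup (F : (set 'M[T]_(m, n))^nat) :
  (forall i, g_sigma_entries (F i)) -> g_sigma_entries (\bigcup_i F i).
Proof. exact: sigma_algebra_bigcup. Qed.

HB.instance Definition _ := @isMeasurable.Build (measure_matrix_display d)
  'M[T]_(m, n) g_sigma_entries entries_set0 entries_setC entries_bigcup.

Lemma measurable_entry (i : 'I_m) (j : 'I_n) :
  measurable_fun [set: 'M[T]_(m, n)] (fun A => A i j).
Proof.
move=> _ Y mY; apply: sub_sigma_algebra; exists (i, j) => //.
by exists Y.
Qed.

Lemma measurable_fun_matrixP d' (S : measurableType d')
    (f : S -> 'M[T]_(m, n)) :
  measurable_fun setT f <->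
  forall i j, measurable_fun setT (fun s => f s i j).
Proof.
split=> [mf i j|mf].
  exact: (measurableT_comp (measurable_entry i j) mf).
apply: (measurability (\bigcup_(ij in [set: 'I_m * 'I_n])
    preimage_set_system setT (fun A : 'M[T]_(m, n) => A ij.1 ij.2)
      measurable)) => //.
move=> _ [_ [[i j] _ [Y mY <-]] <-].
by rewrite setTI; exact: mf.
Qed.

End measurable_matrix.

Section std_gaussian.
Context {R : realType}.

Definition cons_rV n (p : measurableTypeR R * 'rV[R]_n) : 'rV[R]_n.+1 :=
  row_mx (p.1)%:M p.2 : 'rV[R]_(1 + n).

Lemma cons_rV0 n (p : measurableTypeR R * 'rV[R]_n) : cons_rV p 0 ord0 = p.1.
Proof.
have -> : (ord0 : 'I_n.+1) = lshift n (ord0 : 'I_1) by exact: val_inj.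
by rewrite [LHS]row_mxEl mxE eqxx mulr1n.
Qed.

Lemma cons_rVS n (p : measurableTypeR R * 'rV[R]_n) (i : 'I_n) :
  cons_rV p 0 (lift ord0 i) = p.2 0 i.
Proof.
have -> : lift ord0 i = rshift 1 i by exact: val_inj.
exact: row_mxEr.
Qed.

Lemma measurable_cons_rV n : measurable_fun setT (@cons_rV n).
Proof.
apply/measurable_fun_matrixP => i j; rewrite (ord1 i).
case: (unliftP ord0 j) => [k ->|->].
- under eq_fun do rewrite cons_rVS.
  exact: (measurableT_comp (measurable_entry 0 k) measurable_snd).
- under eq_fun do rewrite cons_rV0.
  exact: measurable_fst.
Qed.

HB.instance Definition _ n :=
  isMeasurableFun.Build _ _ _ _ (@cons_rV n) (@measurable_cons_rV n).

(* N(0, I) on 'rV[R]_n: the law of n independent N(0, 1) coordinates (see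
   std_gaussian_rect below); a Dirac mass for n = 0. *)
Fixpoint std_gaussian n : probability 'rV[R]_n R :=
  match n with
  | 0 => \d_(0 : 'rV[R]_0)
  | n'.+1 => distribution (normal_prob (0 : R) 1 \x std_gaussian n')%E
                          (@cons_rV n')
  end.

Lemma std_gaussian_rect n (A : 'I_n -> set R) :
  (forall i, measurable (A i)) ->
  std_gaussian n [set v | forall i, A i (v 0 i)] =
  (\prod_(i < n) normal_prob (0 : R) 1 (A i))%E.
Proof.
elim: n A => [|n IHn] A mA.
  by rewrite big_ord0 /= diracE mem_set// => -[].
rewrite big_ord_recl -IHn// /= /distribution /pushforward.
have -> : cons_rV (n:=n) @^-1` [set v | forall i, A i (v 0 i)] =
    A ord0 `*` [set v : 'rV[R]_n | forall i, A (lift ord0 i) (v 0 i)].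
  apply/seteqP; split => [p /= h|p /= [h0 hS] i].
    split; first by have := h ord0; rewrite cons_rV0.
    by move=> i; have := h (lift ord0 i); rewrite cons_rVS.
  by case: (unliftP ord0 i) => [k ->|->]; rewrite ?cons_rVS ?cons_rV0.
have mB : measurable [set v : 'rV[R]_n | forall i, A (lift ord0 i) (v 0 i)].
  have -> : [set v : 'rV[R]_n | forall i, A (lift ord0 i) (v 0 i)] =
      \bigcap_(i in [set: 'I_n])
        ((fun v : 'rV[R]_n => v 0 i) @^-1` A (lift ord0 i)).
    by apply/seteqP; split => v /= h i => [_|]; exact: h.
  apply: fin_bigcap_measurable => [|i _]; first exact: finite_finset.
  by rewrite -[X in measurable X]setTI; apply: measurable_entry.
rewrite product_measure1E//; last exact: mA.
Qed.

End std_gaussian.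

Section score.
Context {R : realType}.

Definition dotv n (u v : 'rV[R]_n) : R := \sum_(i < n) u 0 i * v 0 i.

(* The norm `|_| on matrices is the sup norm, hence this definition. *)
Definition norm2 n (u : 'rV[R]_n) : R := Num.sqrt (\sum_(i < n) u 0 i ^+ 2).

Definition Cos n (u v : 'rV[R]_n) : R := dotv u v / (norm2 u * norm2 v).

Definition smoothed d m (f : 'rV[R]_d -> 'rV[R]_m) (u : 'rV[R]_d) : 'rV[R]_m :=
  \row_j fine 'E_(std_gaussian d)[fun eps => f (u + eps) 0 j].

Definition robustness_score d m (f : 'rV[R]_d -> 'rV[R]_m) (x : 'rV[R]_d) : R :=
  2^-1 * (1 + fine 'E_(std_gaussian d)[fun eps => Cos (f (x + eps)) (f x)]).

Definition normalize2 n (u : 'rV[R]_n) : 'rV[R]_n := (norm2 u)^-1 *: u.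

Definition Phi (r : R) : R :=
  fine (normal_prob (0 : R) 1 `]-oo, r]).

(* For 0 < p < 1 this is the unique r with Phi r = p; outside [0, 1] the value
   is arbitrary. *)
Definition Phi_inv (p : R) : \bar R :=
  if p == 0 then -oo%E
  else if p == 1 then +oo%E
  else (xget 0 [set r | Phi r = p])%:E.

Definition argmax K (s : 'I_K -> R) : set 'I_K :=
  [set k | forall l, s l <= s k].

Definition gamma m K (t : 'I_K -> 'rV[R]_m) (z : 'rV[R]_m) (y k : 'I_K) : R :=
  Num.sqrt (1 - (dotv z (t y) - dotv z (t k)) ^+ 2
                / (2 * (1 - dotv (t y) (t k)))).

(* Since every gamma is nonnegative, the default value 0 of the iterated
   maximum is immaterial as soon as some k != y exists, i.e. K >= 2. *)
Definition gamma_top1 m K (t : 'I_K -> 'rV[R]_m) (z : 'rV[R]_m)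
    (y : 'I_K) : R :=
  \big[Num.max/0]_(k < K | k != y) gamma t z y k.

Definition radius_ret d m (f : 'rV[R]_d -> 'rV[R]_m) K (t : 'I_K -> 'rV[R]_m)
    (x : 'rV[R]_d) (y : 'I_K) : \bar R :=
  (Phi_inv (robustness_score f x) -
   Phi_inv ((1 + gamma_top1 t (f x) y) / 2))%E.

End score.

(* Main.v *)
(* Write [u = x' - x], [z = fe x] and [g v = (1 + <fe (x + v), z>) / 2], so that
   the mean of [g] under the standard Gaussian is the robustness score and the
   mean of its translate by [u] is [(1 + <smoothed fe x', z>) / 2].  By the
   Cameron-Martin formula and a Neyman-Pearson comparison with a half-space, a
   [0, 1]-valued function with mean at least [Phi a] has, after translation by
   [u], mean at least [Phi (a - |u|)].  Hence the smoothed feature satisfies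
   [<smoothed fe x', z> > gamma*]; as its norm is at most 1, so does its
   normalization, and a unit vector at such an angle from [z] lies on the same
   side as [z] of each hyperplane orthogonal to [t y - t k]. *)

From HB Require Import structures.
Require Import Defs.
From mathcomp Require Import all_boot all_order all_algebra.
From mathcomp Require Import all_classical all_reals all_analysis.
From mathcomp Require Import measurable_realfun ring lra.

Set Implicit Arguments.
Unset Strict Implicit.
Unset Printing Implicit Defensive.

Import Order.TTheory GRing.Theory Num.Theory.
Import numFieldNormedType.Exports.
Local Open Scope classical_set_scope.
Local Open Scope ring_scope.

(** * The one-dimensional Gaussian *)

Section normal_law.
Context {R : realType}.
Local Notation mu := (@lebesgue_measure R).
Local Open Scope ereal_scope.

(** Change of variables through the Radon-Nikodym derivative, which equals [normal_pdf] almost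
    everywhere because both have the same integral over every measurable set. *)
Lemma ge0_integral_normal_prob (m s : R) (f : R -> \bar R) :
  measurable_fun [set: R] f -> (forall x, 0 <= f x) ->
  \int[normal_prob m s]_x f x = \int[mu]_x (f x * (normal_pdf m s x)%:E).
Proof.
move=> mf f0.
have dom := normal_prob_dominates m s.
rewrite -(Radon_Nikodym_SigmaFinite.change_of_variables dom f0 measurableT mf).
have mg := measurable_int _ (Radon_Nikodym_SigmaFinite.f_integrable dom).
have mp : measurable_fun setT (fun x => (normal_pdf m s x)%:E).
  apply/measurable_EFinP; exact: measurable_normal_pdf.
apply: ae_eq_integral => //.
- exact: emeasurable_funM.
- exact: emeasurable_funM.
- apply: ae_eqe_mul2l; apply: integral_ae_eq => //.
    exact: Radon_Nikodym_SigmaFinite.f_integrable.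
  move=> E _ mE.
  by rewrite -(Radon_Nikodym_SigmaFinite.f_integral dom).
Qed.

Lemma measurable_affine (m s : R) :
  measurable_fun [set: R] (fun x : R => (m + s * x)%R : measurableTypeR R).
Proof. by apply: measurable_funD => //; exact: measurable_funM. Qed.

(** By uniqueness of Lebesgue measure: the scaled pushforward gives each interval []a, b]] its
    length. *)
Lemma lebesgue_measure_affine (m s : R) (A : set R) : (0 < s)%R -> measurable A ->
  s%:E * mu ((fun x => m + s * x)%R @^-1` A) = mu A.
Proof.
move=> s0 mA.
pose h (x : measurableTypeR R) : measurableTypeR R := (m + s * x)%R.
have mh : measurable_fun setT h := measurable_affine m s.
pose nu := mscale (NngNum (ltW s0)) (pushforward mu h).
apply/esym.
apply: (@lebesgue_measure_unique _ (nu mh)) => //.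
move=> _ [[a b]] _ <-.
rewrite /= /nu /mscale /= /pushforward.
have -> : h @^-1` [set` `]a, b]%R] = [set` `]((a - m) / s), ((b - m) / s)]%R].
  apply/seteqP; split => x /=; rewrite /h !in_itv /= ltr_pdivrMr// ler_pdivlMr//;
    by rewrite ltrBlDl lerBrDl (mulrC x).
rewrite !lebesgue_measure_itv/= !lte_fin ltr_pM2r ?invr_gt0// ltrD2r.
case: ifPn => _; last by rewrite mule0.
by rewrite -!EFinB -EFinM; congr EFin; field; rewrite gt_eqF.
Qed.

Lemma ge0_integral_lebesgue_affine (m s : R) (f : R -> \bar R) : (0 < s)%R ->
  measurable_fun [set: R] f -> (forall x, 0 <= f x) ->
  \int[mu]_x f x = \int[mu]_x (s%:E * f (m + s * x)%R).
Proof.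
move=> s0 mf f0.
pose h (x : measurableTypeR R) : measurableTypeR R := (m + s * x)%R.
have mh : measurable_fun setT h := measurable_affine m s.
rewrite ge0_integralZl//; last 2 first.
  exact: (measurableT_comp mf mh).
  by rewrite lee_fin ltW.
have := @ge0_integral_pushforward _ _ _ _ _ h mh mu setT f measurableT mf (fun y _ => f0 y).
rewrite preimage_setT => <-.
rewrite -(@ge0_integral_mscale _ _ _ (pushforward mu h) setT measurableT (NngNum (ltW s0)))//.
apply: eq_measure_integral => A mA _.
exact/esym/lebesgue_measure_affine.
Qed.

Lemma ge0_integral_lebesgueN (f : R -> \bar R) :
  measurable_fun [set: R] f -> (forall x, 0 <= f x) ->
  \int[mu]_x f x = \int[mu]_x f (- x)%R.
Proof.
move=> mf f0.
have mh : measurable_fun setT (-%R : measurableTypeR R -> measurableTypeR R).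
  exact: oppr_measurable.
have := @ge0_integral_pushforward _ _ _ _ _ _ mh mu setT f measurableT mf (fun y _ => f0 y).
rewrite preimage_setT => <-.
apply: eq_measure_integral => A mA _.
exact/esym/lebesgue_measureN.
Qed.

Lemma normal_pdf_standardize (m s x : R) : (0 < s)%R ->
  normal_pdf m s x = (s^-1 * normal_pdf 0 1 ((x - m) / s))%R.
Proof.
move=> s0; rewrite !normal_pdfE ?gt_eqF//.
rewrite /normal_peak /normal_fun expr1n mul1r -mulrnAr sqrtrM ?sqr_ge0//.
rewrite sqrtr_sqr gtr0_norm// invfM mulrA; congr (_ * expR _)%R.
by field; rewrite gt_eqF.
Qed.

Lemma ge0_integral_normal_affine (m s : R) (f : R -> \bar R) : (0 < s)%R ->
  measurable_fun [set: R] f -> (forall x, 0 <= f x) ->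
  \int[normal_prob m s]_x f x = \int[normal_prob 0%R 1%R]_x f (m + s * x)%R.
Proof.
move=> s0 mf f0.
have mfs : measurable_fun [set: R] (fun x => f (m + s * x)%R).
  exact: (measurableT_comp mf (measurable_affine m s)).
apply: (etrans (ge0_integral_normal_prob m s mf f0)).
apply: (etrans _ (esym (ge0_integral_normal_prob 0%R 1%R mfs (fun x => f0 _)))).
apply: (etrans (ge0_integral_lebesgue_affine m s0 _ _)).
- apply: emeasurable_funM => //.
  by apply/measurable_EFinP; exact: measurable_normal_pdf.
- by move=> x; rewrite mule_ge0// lee_fin normal_pdf_ge0.
apply: eq_integral => x _; rewrite muleCA normal_pdf_standardize//; congr (_ * _).
rewrite -EFinM mulrA divff ?gt_eqF// mul1r; congr (normal_pdf _ _ _)%:E.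
by field; rewrite gt_eqF.
Qed.

Lemma ge0_integral_normalN (f : R -> \bar R) :
  measurable_fun [set: R] f -> (forall x, 0 <= f x) ->
  \int[normal_prob 0%R 1%R]_x f x = \int[normal_prob 0%R 1%R]_x f (- x)%R.
Proof.
move=> mf f0.
have mfN : measurable_fun [set: R] (fun x => f (- x)%R).
  exact: (measurableT_comp mf (@oppr_measurable R setT)).
apply: (etrans (ge0_integral_normal_prob 0%R 1%R mf f0)).
apply: (etrans _ (esym (ge0_integral_normal_prob 0%R 1%R mfN (fun x => f0 _)))).
apply: (etrans (ge0_integral_lebesgueN _ _)).
- apply: emeasurable_funM => //.
  by apply/measurable_EFinP; exact: measurable_normal_pdf.
- by move=> x; rewrite mule_ge0// lee_fin normal_pdf_ge0.
apply: eq_integral => x _; rewrite !normal_pdfE ?oner_neq0//.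
by rewrite /normal_fun !subr0 sqrrN.
Qed.

(** Cameron-Martin in dimension one: the exponential weight is the ratio of the densities of
    [N(a, 1)] and [N(0, 1)]. *)
Lemma ge0_integral_normal_shift (a : R) (f : R -> \bar R) :
  measurable_fun [set: R] f -> (forall x, 0 <= f x) ->
  \int[normal_prob 0%R 1%R]_x f (x + a)%R =
  \int[normal_prob 0%R 1%R]_x (f x * (expR (a * x - a ^+ 2 / 2))%:E).
Proof.
move=> mf f0.
have mg : measurable_fun [set: R]
    (fun x : R => f x * (expR (a * x - a ^+ 2 / 2))%:E).
  apply: emeasurable_funM => //; apply/measurable_EFinP.
  by apply: measurableT_comp => //; apply: measurable_funB.
have g0 x : 0 <= f x * (expR (a * x - a ^+ 2 / 2))%:E.
  by rewrite mule_ge0// lee_fin expR_ge0.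
transitivity (\int[normal_prob 0%R 1%R]_x f (a + 1 * x)%R).
  by apply: eq_integral => x _; rewrite mul1r addrC.
apply: (etrans (esym (ge0_integral_normal_affine a ltr01 mf f0))).
apply: (etrans (ge0_integral_normal_prob a 1%R mf f0)).
apply: (etrans _ (esym (ge0_integral_normal_prob 0%R 1%R mg g0))).
apply: eq_integral => x _; rewrite -muleA; congr (_ * _).
rewrite -EFinM !normal_pdfE ?oner_neq0// mulrCA; congr (_ * _)%:E.
by rewrite /normal_fun -expRD; congr expR; field.
Qed.

(** Two factorizations of the joint density of [x] and [s = a x + b y], for independent standard
    Gaussians [x] and [y]: the law of [s] given [x] times that of [x], and the law of [s] times that
    of [x] given [s]. *)
Lemma normal_pdf_convolution (a b c x s : R) :
  (0 < b)%R -> (0 < c)%R -> (c ^+ 2 = a ^+ 2 + b ^+ 2)%R ->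
  (normal_pdf (a * x) b s * normal_pdf 0 1 x =
   normal_pdf 0 c s * normal_pdf (a * s / c ^+ 2) (b / c) x)%R.
Proof.
move=> b0 c0 c2.
rewrite (normal_pdf_standardize (a * x))// (normal_pdf_standardize 0 s)//.
rewrite (normal_pdf_standardize (a * s / c ^+ 2)) ?divr_gt0//.
rewrite !normal_pdfE ?oner_neq0// /normal_fun.
have bn0 : (b != 0)%R by rewrite gt_eqF.
have cn0 : (c != 0)%R by rewrite gt_eqF.
set p := normal_peak 1.
set u := expR _; set v := expR _; set w := expR _; set z := expR _.
have uvwz : (u * v = w * z)%R.
  rewrite /u /v /w /z -!expRD; congr expR.
  apply/eqP; rewrite -subr_eq0; apply/eqP.
  (* The cofactor makes the difference of the two exponents an explicit multiple of
     [a ^+ 2 + b ^+ 2 - c ^+ 2], an identity of rational functions; [c2] is needed only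
     afterwards. *)
  transitivity ((a ^+ 2 + b ^+ 2 - c ^+ 2) *
      - ((x ^+ 2 - s ^+ 2 / c ^+ 2) / (2 * b ^+ 2)))%R.
    by field; rewrite bn0 cn0.
  by rewrite -c2 subrr mul0r.
transitivity (p ^+ 2 / b * (u * v))%R; first by field.
by rewrite uvwz; field; rewrite bn0 cn0.
Qed.

(* [ax + by] with [x], [y] independent standard Gaussians is [N(0, a^2 + b^2)];
   for [b = 0] this uses the symmetry of the Gaussian. *)
Lemma ge0_integral_normal_sum (a b : R) (f : R -> \bar R) :
  (0 <= b)%R -> measurable_fun [set: R] f -> (forall x, 0 <= f x) ->
  \int[normal_prob 0%R 1%R]_x \int[normal_prob 0%R 1%R]_y f (a * x + b * y)%R =
  \int[normal_prob 0%R 1%R]_x f (Num.sqrt (a ^+ 2 + b ^+ 2) * x)%R.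
Proof.
move=> b_ge0 mf f0.
have [b0|bn0] := eqVneq b 0%R.
  have -> : Num.sqrt (a ^+ 2 + b ^+ 2) = `|a|%R by rewrite b0 expr0n addr0 sqrtr_sqr.
  transitivity (\int[normal_prob 0%R 1%R]_x f (a * x)%R).
    apply: eq_integral => x _.
    rewrite (eq_integral (cst (f (a * x)%R))); last first.
      by move=> y _; rewrite b0 mul0r addr0.
    by rewrite integral_cst//= probability_setT mule1.
  have [a0|a0] := ger0P a; first by [].
  have mfa : measurable_fun [set: R] (fun x => f (a * x)%R).
    by apply: (measurableT_comp mf); exact: mulrl_measurable.
  apply: (etrans (ge0_integral_normalN mfa (fun x => f0 _))).
  by apply: eq_integral => x _; rewrite mulrN mulNr.
have b0 : (0 < b)%R by rewrite lt_neqAle eq_sym bn0.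
set c := Num.sqrt _.
have c2 : (c ^+ 2 = a ^+ 2 + b ^+ 2)%R.
  by rewrite sqr_sqrtr// addr_ge0 ?sqr_ge0.
have c0 : (0 < c)%R by rewrite sqrtr_gt0 ltr_wpDl ?sqr_ge0// exprn_gt0.
(* [f] times the joint density of [(x, s)], factored so that after exchanging the integrals the one
   over [x] is that of a density and equals 1. *)
pose h (p : measurableTypeR R * measurableTypeR R) : \bar R :=
  f p.2 * (normal_pdf 0 c p.2)%:E * (normal_pdf (a * p.2 / c ^+ 2) (b / c) p.1)%:E.
have bc0 : (0 < b / c)%R by rewrite divr_gt0.
have mh : measurable_fun setT h.
  apply: emeasurable_funM.
    apply: emeasurable_funM; first exact: (measurableT_comp mf measurable_snd).
    apply/measurable_EFinP.
    exact: (measurableT_comp (measurable_normal_pdf 0 c) measurable_snd).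
  apply/measurable_EFinP.
  (* Standardizing moves the varying mean into the argument of one fixed density, so that
     measurability follows by composition. *)
  under eq_fun do rewrite normal_pdf_standardize//.
  apply: measurable_funM => //.
  apply: (measurableT_comp (measurable_normal_pdf 0 1)).
  apply: measurable_funM => //.
  apply: measurable_funB; first exact: measurable_fst.
  by apply: measurable_funM => //; apply: measurable_funM.
have h0 p : 0 <= h p by rewrite /h !mule_ge0// lee_fin normal_pdf_ge0.
transitivity (\int[mu]_x \int[mu]_s h (x, s)).
  have inner x : \int[normal_prob 0%R 1%R]_y f (a * x + b * y)%R =
      \int[normal_prob (a * x) b]_s f s.
    exact/esym/ge0_integral_normal_affine.
  pose k (p : measurableTypeR R * measurableTypeR R) := f (a * p.1 + b * p.2)%R.
  have mk : measurable_fun setT k.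
    apply: (measurableT_comp mf); apply: measurable_funD.
      by apply: measurable_funM => //; exact: measurable_fst.
    by apply: measurable_funM => //; exact: measurable_snd.
  have mg := measurable_fun_fubini_tonelli_F (m2 := normal_prob 0%R 1%R) k mk
    (fun p => f0 _).
  apply: (etrans (ge0_integral_normal_prob 0%R 1%R mg _)).
    by move=> x; apply: integral_ge0 => y _; exact: f0.
  apply: eq_integral => x _.
  apply: (etrans (congr1 (fun z => z * _)
    (etrans (inner x) (ge0_integral_normal_prob (a * x) b mf f0)))).
  have mF : measurable_fun [set: R] (fun s => f s * (normal_pdf (a * x) b s)%:E).
    apply: emeasurable_funM => //.
    by apply/measurable_EFinP; exact: measurable_normal_pdf.
  have F0 s : 0 <= f s * (normal_pdf (a * x) b s)%:E.
    by rewrite mule_ge0// lee_fin normal_pdf_ge0.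
  have P0 : 0 <= (normal_pdf 0 1 x)%:E by rewrite lee_fin normal_pdf_ge0.
  apply: (etrans (esym (ge0_integralZr mu measurableT mF (fun s _ => F0 s) P0))).
  apply: eq_integral => s _.
  by rewrite /h/= -!muleA -!EFinM (normal_pdf_convolution _ _ b0 c0 c2).
apply: (etrans (fubini_tonelli h mh h0)).
transitivity (\int[normal_prob 0%R c]_s f s); last first.
  apply: (etrans (ge0_integral_normal_affine 0%R c0 mf f0)).
  by apply: eq_integral => x _; rewrite add0r.
apply: (etrans _ (esym (ge0_integral_normal_prob 0%R c mf f0))).
apply: eq_integral => s _.
rewrite /h /= ge0_integralZl//; last 3 first.
- by apply/measurable_EFinP; exact: measurable_normal_pdf.
- by move=> x _; rewrite lee_fin normal_pdf_ge0.
- by rewrite mule_ge0// lee_fin normal_pdf_ge0.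
by rewrite integral_normal_pdf mule1.
Qed.

End normal_law.

(** * Translations and linear forms under [std_gaussian] *)

Section std_gaussian_integral.
Context {R : realType}.
Implicit Types n : nat.
Local Notation N01 := (normal_prob (0 : R) 1).

Definition tail_rV n (u : 'rV[R]_n.+1) : 'rV[R]_n := \row_j u 0 (lift ord0 j).

Lemma dotv_cons_rV n (u : 'rV[R]_n.+1) (x : R) (v : 'rV[R]_n) :
  dotv u (cons_rV (x, v)) = u 0 ord0 * x + dotv (tail_rV u) v.
Proof.
rewrite /dotv big_ord_recl cons_rV0/=; congr (_ + _).
by apply: eq_bigr => i _; rewrite cons_rVS mxE.
Qed.

Lemma norm2_sqr n (u : 'rV[R]_n) : norm2 u ^+ 2 = \sum_(i < n) u 0 i ^+ 2.
Proof. by rewrite sqr_sqrtr// sumr_ge0// => i _; exact: sqr_ge0. Qed.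

Lemma norm2_tail_rV n (u : 'rV[R]_n.+1) :
  norm2 u ^+ 2 = u 0 ord0 ^+ 2 + norm2 (tail_rV u) ^+ 2.
Proof.
rewrite !norm2_sqr big_ord_recl/=; congr (_ + _).
by apply: eq_bigr => i _; rewrite mxE.
Qed.

Lemma cons_rVD n (x : R) (v : 'rV[R]_n) (u : 'rV[R]_n.+1) :
  cons_rV (x, v) + u = cons_rV (x + u 0 ord0, v + tail_rV u).
Proof.
apply/rowP => i; rewrite mxE; case: (unliftP ord0 i) => [k ->|->].
  by rewrite !cons_rVS/= !mxE.
by rewrite !cons_rV0.
Qed.

Lemma measurable_addr_rV n (u : 'rV[R]_n) :
  measurable_fun [set: 'rV[R]_n] (fun v => v + u).
Proof.
apply/measurable_fun_matrixP => i j.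
under eq_fun do rewrite mxE.
by apply: measurable_funD => //; exact: measurable_entry.
Qed.

Lemma measurable_dotv d (T : measurableType d) n (f : T -> 'rV[R]_n) (u : 'rV[R]_n) :
  measurable_fun [set: T] f -> measurable_fun [set: T] (fun x => dotv (f x) u).
Proof.
move=> /measurable_fun_matrixP mf; apply: measurable_sum => i.
by apply: measurable_funM.
Qed.

Lemma dotvC n (u v : 'rV[R]_n) : dotv u v = dotv v u.
Proof. by apply: eq_bigr => i _; rewrite mulrC. Qed.

Lemma measurable_dotvr n (u : 'rV[R]_n) :
  measurable_fun [set: 'rV[R]_n] (fun v => dotv u v).
Proof. by under eq_fun do rewrite dotvC; exact: measurable_dotv. Qed.

Local Open Scope ereal_scope.

Lemma ge0_integral_std_gaussianS n (f : 'rV[R]_n.+1 -> \bar R) :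
  measurable_fun [set: 'rV[R]_n.+1] f -> (forall v, 0 <= f v) ->
  \int[std_gaussian n.+1]_v f v =
  \int[N01]_x \int[std_gaussian n]_v f (cons_rV (x, v)).
Proof.
move=> mf f0; rewrite /= ge0_integral_distribution//.
have mfc : measurable_fun setT (f \o @cons_rV R n).
  exact: (measurableT_comp mf (@measurable_cons_rV R n)).
exact: (fubini_tonelli1 _ mfc (fun p => f0 _)).
Qed.

(** Cameron-Martin by induction on the dimension: shift the tail, then the first coordinate. The
    weights multiply to the right one since [dotv] and the squared norm are sums over
    coordinates. *)
Lemma ge0_integral_std_gaussian_shift n (u : 'rV[R]_n) (f : 'rV[R]_n -> \bar R) :
  measurable_fun [set: 'rV[R]_n] f -> (forall v, 0 <= f v) ->
  \int[std_gaussian n]_v f (v + u)%R =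
  \int[std_gaussian n]_v (f v * (expR (dotv u v - norm2 u ^+ 2 / 2))%:E).
Proof.
elim: n u f => [|n IHn] u f mf f0.
  apply: eq_integral => v _.
  have -> : (v + u)%R = v by apply/rowP => -[].
  by rewrite norm2_sqr /dotv !big_ord0 mul0r subr0 expR0 mule1.
have mfu : measurable_fun [set: 'rV[R]_n.+1] (fun v => f (v + u)%R).
  exact: (measurableT_comp mf (measurable_addr_rV u)).
apply: (etrans (ge0_integral_std_gaussianS mfu (fun _ => f0 _))).
set w := tail_rV u.
have mE m (z : 'rV[R]_m) : measurable_fun [set: 'rV[R]_m]
    (fun v => (expR (dotv z v - norm2 z ^+ 2 / 2))%:E).
  apply/measurable_EFinP; apply: measurableT_comp => //.
  by apply: measurable_funB => //; exact: measurable_dotvr.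
have E0 m (z v : 'rV[R]_m) : 0 <= (expR (dotv z v - norm2 z ^+ 2 / 2))%:E.
  by rewrite lee_fin expR_ge0.
have mfe : measurable_fun [set: 'rV[R]_n.+1]
    (fun v => f v * (expR (dotv u v - norm2 u ^+ 2 / 2))%:E).
  by apply: emeasurable_funM => //; exact: mE.
apply: (etrans _ (esym (ge0_integral_std_gaussianS mfe
  (fun v => mule_ge0 (f0 v) (E0 _ u v))))).
pose h (p : measurableTypeR R * 'rV[R]_n) :=
  f (cons_rV p) * (expR (dotv w p.2 - norm2 w ^+ 2 / 2))%:E.
have mh : measurable_fun setT h.
  apply: emeasurable_funM.
    exact: (measurableT_comp mf (@measurable_cons_rV R n)).
  exact: (measurableT_comp (mE n w) measurable_snd).
have h0 p : 0 <= h p by rewrite mule_ge0.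
have mG := measurable_fun_fubini_tonelli_F (m2 := std_gaussian n) h mh h0.
(* The tail shift has become a weight inside [h]; the shift of the first coordinate is still in the
   argument. *)
transitivity (\int[N01]_x fubini_F (std_gaussian n) h (x + u 0%R ord0)%R).
  apply: eq_integral => x _.
  transitivity (\int[std_gaussian n]_v f (cons_rV (x + u 0 ord0, v + w)%R)).
    by apply: eq_integral => v _; rewrite cons_rVD.
  have mfx : measurable_fun [set: 'rV[R]_n] (fun v => f (cons_rV (x + u 0 ord0, v)%R)).
    apply: (measurableT_comp mf); apply: (measurableT_comp (@measurable_cons_rV R n)).
    exact: measurable_pair1.
  exact: (IHn w _ mfx (fun _ => f0 _)).
apply: (etrans (ge0_integral_normal_shift _ mG _)).
  by move=> x; apply: integral_ge0 => v _; exact: h0.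
apply: eq_integral => x _.
have mhx : measurable_fun [set: 'rV[R]_n] (fun v => h (x, v)).
  by apply: (measurableT_comp mh); exact: measurable_pair1.
set k := (expR _)%:E.
have k0 : 0 <= k by rewrite lee_fin expR_ge0.
apply: (etrans (esym (ge0_integralZr (std_gaussian n) measurableT mhx (fun v _ => h0 (x, v)) k0))).
apply: eq_integral => v _.
rewrite /h /k -muleA -EFinM -expRD/=; congr (_ * (expR _)%:E).
by rewrite dotv_cons_rV norm2_tail_rV -/w; field.
Qed.

(** A linear form has law [N(0, |u|^2)]: peel off one coordinate at a time and add independent
    Gaussians with [ge0_integral_normal_sum]. *)
Lemma ge0_integral_std_gaussian_dotv n (u : 'rV[R]_n) (f : R -> \bar R) :
  measurable_fun [set: R] f -> (forall x, 0 <= f x) ->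
  \int[std_gaussian n]_v f (dotv u v) = \int[N01]_x f (norm2 u * x)%R.
Proof.
(* [f] stays general because the induction hypothesis is applied to its translates by
   [u 0 ord0 * x]. *)
move=> mf f0; elim: n u => [|n IHn] u in f mf f0 *.
  have -> : norm2 u = 0%R by rewrite /norm2 big_ord0 sqrtr0.
  transitivity (f 0%R).
    rewrite (eq_integral (cst (f 0%R))); last first.
      by move=> v _; rewrite /dotv big_ord0.
    by rewrite integral_cst//= [X in _ * X]probability_setT mule1.
  rewrite (eq_integral (cst (f 0%R))); last first.
    by move=> v _; rewrite mul0r.
  by rewrite integral_cst//= probability_setT mule1.
have md : measurable_fun [set: 'rV[R]_n.+1] (fun v => f (dotv u v)).
  exact: (measurableT_comp mf (measurable_dotvr u)).
apply: (etrans (ge0_integral_std_gaussianS md (fun _ => f0 _))).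
have -> : norm2 u = Num.sqrt (u 0 ord0 ^+ 2 + norm2 (tail_rV u) ^+ 2)%R.
  by rewrite -norm2_tail_rV sqrtr_sqr ger0_norm// sqrtr_ge0.
apply: (etrans _ (ge0_integral_normal_sum (u 0%R ord0) (sqrtr_ge0 _) mf f0)).
apply: eq_integral => x _.
transitivity (\int[std_gaussian n]_v f (u 0 ord0 * x + dotv (tail_rV u) v)%R).
  by apply: eq_integral => v _; rewrite dotv_cons_rV.
apply: (IHn (tail_rV u) (fun z => f (u 0 ord0 * x + z)%R)) => //.
by apply: (measurableT_comp mf); exact: measurable_funD.
Qed.

End std_gaussian_integral.

(** * Gaussian shift inequality *)

Section Phi.
Context {R : realType}.
Local Notation N01 := (normal_prob (0 : R) 1).

Lemma PhiE (a : R) : (Phi a)%:E = N01 `]-oo, a].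
Proof. by rewrite /Phi fineK// fin_num_measure. Qed.

Lemma Phi_le1 (a : R) : Phi a <= 1.
Proof. by rewrite -lee_fin PhiE probability_le1. Qed.

Lemma Phi_sub (x y : R) : x <= y -> (Phi y - Phi x)%:E = N01 `]x, y].
Proof.
move=> xy; rewrite EFinB.
have -> : (Phi y)%:E = ((Phi x)%:E + N01 `]x, y])%E.
  rewrite !PhiE -[RHS]measureU//.
    by rewrite -(@itv_bndbnd_setU _ _ -oo%O (BRight x) (BRight y)).
  apply/seteqP; split => // t [] /=; rewrite !in_itv/= => tx /andP[].
  by rewrite ltNge tx.
by rewrite (addeC (Phi x)%:E) addeK.
Qed.

Lemma Phi_lt : {homo @Phi R : x y / x < y}.
Proof.
move=> x y xy; rewrite -subr_gt0 -lte_fin Phi_sub ?ltW//.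
(* A positive lower bound for the density on []x, y]], where [z ^+ 2 <= x ^+ 2 + y ^+ 2]. *)
pose m := normal_peak 1 * expR (- (x ^+ 2 + y ^+ 2) / (1 ^+ 2 *+ 2)).
have m0 : 0 < m by rewrite mulr_gt0 ?expR_gt0// normal_peak_gt0// oner_neq0.
apply: (@lt_le_trans _ _ (\int[lebesgue_measure]_(z in `]x, y]) (cst m%:E z))%E).
  rewrite integral_cst//= lebesgue_measure_itv/= lte_fin xy -EFinB -EFinM lte_fin.
  by rewrite mulr_gt0// subr_gt0.
apply: ge0_le_integral => //=.
- by move=> z _; rewrite lee_fin ltW.
- apply/measurable_EFinP; apply: measurable_funTS; exact: measurable_normal_pdf.
move=> z; rewrite in_itv/= => /andP[xz zy].
rewrite lee_fin normal_pdfE ?oner_neq0// ler_pM2l ?normal_peak_gt0 ?oner_neq0//.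
rewrite ler_expR subr0 ler_pM2r ?invr_gt0 ?expr1n// lerN2.
by have [z0|z0] := leP 0 z; nra.
Qed.

(** [Phi] is Lipschitz, with the peak of the density as constant. *)
Lemma Phi_continuous : continuous (@Phi R).
Proof.
have peak0 : 0 < normal_peak (1 : R) by rewrite normal_peak_gt0// oner_neq0.
have lip (x y : R) : x <= y -> `|Phi y - Phi x| <= normal_peak 1 * (y - x).
  move=> xy; rewrite ger0_norm; last first.
    by move: xy; rewrite le_eqVlt => /predU1P[->|/Phi_lt/ltW]; rewrite ?subrr// subr_ge0.
  rewrite -lee_fin Phi_sub//.
  apply: (@le_trans _ _ (\int[lebesgue_measure]_(z in `]x, y])
      (cst (normal_peak (1 : R))%:E z))%E).
    apply: ge0_le_integral => //=.
    - by move=> z _; rewrite lee_fin normal_pdf_ge0.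
    - by apply/measurable_EFinP; apply: measurable_funTS; exact: measurable_normal_pdf.
    by move=> z _; rewrite lee_fin normal_pdf_ub// oner_neq0.
  rewrite integral_cst//= lebesgue_measure_itv/= lte_fin.
  move: xy; rewrite le_eqVlt => /predU1P[->|->]; last by rewrite -EFinB -EFinM.
  by rewrite ltxx mule0 subrr mulr0.
move=> x; apply/cvgrPdist_lt => e e0.
apply/nbhs_ballP; exists (e / normal_peak 1); first by rewrite /= divr_gt0.
move=> y; rewrite /ball/= ltr_pdivlMr// mulrC; apply: le_lt_trans.
have [xy|/ltW yx] := leP x y.
  by rewrite distrC (distrC x) (ger0_norm (x := y - x)) ?subr_ge0// lip.
by rewrite (ger0_norm (x := x - y)) ?subr_ge0// lip.
Qed.

Lemma Phi_surj (p : R) : 0 < p < 1 -> exists a, Phi a = p.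
Proof.
move=> /andP[p0 p1].
(* The identity as a random variable has [Phi] as its distribution function; the limits of the
   latter at both infinities provide the end points for the intermediate value theorem. *)
pose X : {mfun measurableTypeR R >-> R} := HB.pack (idfun : measurableTypeR R -> R)
  (isMeasurableFun.Build _ _ _ _ (idfun : measurableTypeR R -> R) (@measurable_id _ _ setT)).
have XE r : cdf (P := N01) X r = (Phi r)%:E by rewrite PhiE.
have [a pa] : exists a, Phi a < p.
  have p0' : (0%:E < p%:E)%E by rewrite lte_fin.
  have [M [_ hM]] := @cvg_cdfNy0 _ _ _ N01 X _ (open_ereal_lt' p0').
  by exists (M - 1); rewrite -lte_fin -XE; apply: hM; rewrite ltrBlDr ltrDl.
have [b pb] : exists b, p < Phi b.
  have p1' : (p%:E < 1%:E)%E by rewrite lte_fin.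
  have [M [_ hM]] := @cvg_cdfy1 _ _ _ N01 X _ (open_ereal_gt' p1').
  by exists (M + 1); rewrite -lte_fin -XE; apply: hM; rewrite ltrDl.
have ab : a <= b.
  by rewrite leNgt; apply/negP => /Phi_lt /(lt_trans pb) /(lt_trans pa); rewrite ltxx.
have [||c _ <-] := @IVT R (@Phi R) a b p ab; last by exists c.
- by apply: continuous_subspaceT; exact: Phi_continuous.
- by rewrite ge_min le_max (ltW pa) (ltW pb) orbT.
Qed.

End Phi.

Section neyman_pearson.
Context {R : realType}.
Local Notation N01 := (normal_prob (0 : R) 1).
Local Open Scope ereal_scope.

Lemma norm2_eq0 n (u : 'rV[R]_n) : norm2 u = 0%R -> u = 0%R.
Proof.
move=> u0; apply/rowP => i; rewrite mxE; apply/eqP; rewrite -sqrf_eq0; apply/eqP.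
have : (\sum_(i < n) u 0 i ^+ 2)%R = 0%R by rewrite -norm2_sqr u0 expr0n.
by move/psumr_eq0P => -> // j _; exact: sqr_ge0.
Qed.

Lemma integral_std_gaussian_halfspace n (u : 'rV[R]_n) (a : R) : (0 < norm2 u)%R ->
  \int[std_gaussian n]_v (\1_`]-oo, (a * norm2 u)%R] (dotv u v))%:E = (Phi a)%:E.
Proof.
move=> u0.
rewrite (ge0_integral_std_gaussian_dotv u (f := fun x => (\1_`]-oo, (a * norm2 u)%R] x)%:E)).
- rewrite PhiE -(setIT [set` `]-oo, a]%R]) -integral_indic//.
  apply: eq_integral => x _; congr EFin; rewrite !indicE; congr ((_ : bool)%:R).
  by rewrite !mem_setE/= !in_itv/= mulrC ler_pM2r.
- by apply/measurable_EFinP; exact: measurable_indic.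
- by move=> x; rewrite lee_fin.
Qed.

(* Neyman-Pearson: among all [g] with a given mean, the mean after the shift by
   [u] is minimized by the indicator [g0] of a half-space [dotv u v <= c],
   because the likelihood ratio [D] of the shift crosses a constant [l]
   exactly at the boundary of that half-space. *)
Lemma le_integral_std_gaussian_shift n (u : 'rV[R]_n) (g : 'rV[R]_n -> R) (a : R) :
  measurable_fun [set: 'rV[R]_n] g -> (forall v, 0 <= g v <= 1)%R ->
  (Phi a)%:E <= \int[std_gaussian n]_v (g v)%:E ->
  (Phi (a - norm2 u))%:E <= \int[std_gaussian n]_v (g (v + u)%R)%:E.
Proof.
move=> mg g01 ag.
have [uE0|un0] := eqVneq (norm2 u) 0%R.
  rewrite uE0 subr0 (norm2_eq0 uE0); apply: (le_trans ag).
  by under [X in _ <= X]eq_integral do rewrite addr0.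
have u0 : (0 < norm2 u)%R by rewrite lt_neqAle eq_sym un0 sqrtr_ge0.
pose G0 (v : 'rV[R]_n) : \bar R := (\1_`]-oo, (a * norm2 u)%R] (dotv u v))%:E.
pose G v : \bar R := (g v)%:E.
pose D v : \bar R := (expR (dotv u v - norm2 u ^+ 2 / 2))%:E.
(* The value of [D] on the boundary [dotv u v = a * norm2 u]. *)
pose l : \bar R := (expR (a * norm2 u - norm2 u ^+ 2 / 2))%:E.
have mG0 : measurable_fun [set: 'rV[R]_n] G0.
  apply/measurable_EFinP.
  apply: (measurableT_comp _ (measurable_dotvr u)).
  exact: measurable_indic.
have mG : measurable_fun [set: 'rV[R]_n] G by exact/measurable_EFinP.
have mD : measurable_fun [set: 'rV[R]_n] D.
  apply/measurable_EFinP; apply: measurableT_comp => //.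
  by apply: measurable_funB => //; exact: measurable_dotvr.
have G00 v : 0 <= G0 v by rewrite lee_fin.
have G_ge0 v : 0 <= G v by rewrite lee_fin; case/andP: (g01 v).
have D0 v : 0 <= D v by rewrite lee_fin expR_ge0.
have l0 : 0 <= l by rewrite lee_fin expR_ge0.
have mGD := emeasurable_funM mG mD.
have mG0D := emeasurable_funM mG0 mD.
have mlG : measurable_fun [set: 'rV[R]_n] (fun v => l * G v).
  by apply: emeasurable_funM.
have mlG0 : measurable_fun [set: 'rV[R]_n] (fun v => l * G0 v).
  by apply: emeasurable_funM.
have IG0 : \int[std_gaussian n]_v G0 v = (Phi a)%:E.
  exact: integral_std_gaussian_halfspace.
(* Translation by [u] adds [norm2 u ^+ 2] to [dotv u v], hence lowers the normalized threshold from
   [a] to [a - norm2 u]. *)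
have IG0D : \int[std_gaussian n]_v (G0 v * D v) = (Phi (a - norm2 u))%:E.
  rewrite -(ge0_integral_std_gaussian_shift u mG0 G00).
  rewrite -(integral_std_gaussian_halfspace (a - norm2 u)%R u0).
  apply: eq_integral => v _; congr EFin; rewrite !indicE; congr ((_ : bool)%:R).
  rewrite !mem_setE/= !in_itv/= mulrBl lerBrDr; congr (_ <= _)%R.
  rewrite -expr2 norm2_sqr /dotv -big_split/=; apply: eq_bigr => i _.
  by rewrite mxE mulrDr expr2.
have -> : \int[std_gaussian n]_v (g (v + u)%R)%:E = \int[std_gaussian n]_v (G v * D v).
  exact: (ge0_integral_std_gaussian_shift u mG G_ge0).
(* The integrated form of [(G0 - G) * (D - l) <= 0], rearranged so that only nonnegative terms occur
   and no subtraction of extended reals is needed. *)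
have key : \int[std_gaussian n]_v (G0 v * D v) + l * \int[std_gaussian n]_v G v <=
           \int[std_gaussian n]_v (G v * D v) + l * \int[std_gaussian n]_v G0 v.
  rewrite -!ge0_integralZl// -!ge0_integralD//; try by move=> v _; rewrite mule_ge0.
  apply: ge0_le_integral => //.
  - by move=> v _; rewrite adde_ge0// mule_ge0.
  - exact: emeasurable_funD.
  - exact: emeasurable_funD.
  move=> v _; rewrite /G0 /G /D /l -!EFinM -!EFinD lee_fin.
  rewrite indicE mem_setE/= in_itv/=; have /andP[gv0 gv1] := g01 v.
  case: (leP (dotv u v) (a * norm2 u)%R) => h /=.
    have : (expR (dotv u v - norm2 u ^+ 2 / 2) <= expR (a * norm2 u - norm2 u ^+ 2 / 2))%R.
      by rewrite ler_expR lerB.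
    by set p := expR _; set q := expR _ => pq; nra.
  have : (expR (a * norm2 u - norm2 u ^+ 2 / 2) <= expR (dotv u v - norm2 u ^+ 2 / 2))%R.
    by rewrite ler_expR lerB// ltW.
  by set p := expR _; set q := expR _ => pq; nra.
(* Adding the finite [l * Phi a] to both sides matches [key], up to replacing [Phi a] by the larger
   mean of [G] on the left. *)
rewrite -IG0D -(leeD2rE (x := l * (Phi a)%:E)); last by rewrite -EFinM.
rewrite -{2}IG0; apply: le_trans key; rewrite leeD2l//.
exact: lee_wpmul2l.
Qed.

End neyman_pearson.

(** * Euclidean geometry and expectations of unit vectors *)

Section euclidean.
Context {R : realType}.
Implicit Types n : nat.

Lemma dotvDl n (u v w : 'rV[R]_n) : dotv (u + v) w = dotv u w + dotv v w.
Proof. by rewrite /dotv -big_split/=; apply: eq_bigr => i _; rewrite mxE mulrDl. Qed.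

Lemma dotvZl n (a : R) (u v : 'rV[R]_n) : dotv (a *: u) v = a * dotv u v.
Proof. by rewrite /dotv mulr_sumr; apply: eq_bigr => i _; rewrite mxE mulrA. Qed.

Lemma dotvBl n (u v w : 'rV[R]_n) : dotv (u - v) w = dotv u w - dotv v w.
Proof. by rewrite dotvDl -scaleN1r dotvZl mulN1r. Qed.

Lemma dotvBr n (u v w : 'rV[R]_n) : dotv w (u - v) = dotv w u - dotv w v.
Proof. by rewrite !(dotvC w) dotvBl. Qed.

Lemma dotvZr n (a : R) (u v : 'rV[R]_n) : dotv u (a *: v) = a * dotv u v.
Proof. by rewrite !(dotvC u) dotvZl. Qed.

Lemma dotvv n (u : 'rV[R]_n) : dotv u u = norm2 u ^+ 2.
Proof. by rewrite norm2_sqr; apply: eq_bigr => i _; rewrite expr2. Qed.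

Lemma norm2_ge0 n (u : 'rV[R]_n) : 0 <= norm2 u.
Proof. exact: sqrtr_ge0. Qed.

Lemma norm2Z n (a : R) (u : 'rV[R]_n) : norm2 (a *: u) = `|a| * norm2 u.
Proof.
apply/eqP; rewrite -(eqrXn2 (n := 2))// ?mulr_ge0 ?norm2_ge0//.
by rewrite -dotvv dotvZl dotvZr dotvv exprMn real_normK ?num_real// mulrA.
Qed.

Lemma norm2_normalize2 n (u : 'rV[R]_n) : 0 < norm2 u -> norm2 (normalize2 u) = 1.
Proof.
by move=> u0; rewrite norm2Z ger0_norm ?invr_ge0 ?norm2_ge0// mulVf ?gt_eqF.
Qed.

Lemma cauchy_schwarz n (u v : 'rV[R]_n) : `|dotv u v| <= norm2 u * norm2 v.
Proof.
rewrite -(ler_pXn2r (n := 2))// ?nnegrE ?mulr_ge0 ?norm2_ge0//.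
rewrite real_normK ?num_real// exprMn -!dotvv.
have [v0|v0] := eqVneq (norm2 v) 0.
  by rewrite (norm2_eq0 v0) -(scale0r (0 : 'rV[R]_n)) !dotvZr !mul0r expr0n mulr0.
have vv0 : 0 < dotv v v by rewrite dotvv exprn_gt0// lt_neqAle eq_sym v0 norm2_ge0.
(* This squared norm is [dotv v v] times the difference [dotv u u * dotv v v - dotv u v ^+ 2]. *)
have : 0 <= norm2 (dotv v v *: u - dotv u v *: v) ^+ 2 by exact: sqr_ge0.
rewrite -dotvv dotvBl !dotvBr !dotvZl !dotvZr (dotvC v u).
move=> h; rewrite -(ler_pM2l vv0) -subr_ge0; apply: le_trans h _.
by rewrite le_eqVlt; apply/orP; left; apply/eqP; ring.
Qed.

Lemma dotv_unit_bounds n (u v : 'rV[R]_n) : norm2 u = 1 -> norm2 v = 1 ->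
  -1 <= dotv u v <= 1.
Proof. by move=> u1 v1; rewrite -ler_norml (le_trans (cauchy_schwarz u v))// u1 v1 mulr1. Qed.

(* If [w] were on the wrong side of the hyperplane orthogonal to [r - s], then
   [dotv w z] would be at most the norm of the projection of [z] on it. *)
Lemma dotv_lt_of_angle n (z w r s : 'rV[R]_n) :
  norm2 w = 1 -> norm2 z = 1 -> norm2 r = 1 -> norm2 s = 1 ->
  dotv z s < dotv z r ->
  Num.sqrt (1 - (dotv z r - dotv z s) ^+ 2 / (2 * (1 - dotv r s))) < dotv w z ->
  dotv w s < dotv w r.
Proof.
move=> w1 z1 r1 s1 zsr; rewrite -dotvBr.
(* With this denominator, the square root is the norm of the projection [p] of [z] on the hyperplane
   orthogonal to [r - s]. *)
have -> : 2 * (1 - dotv r s) = dotv (r - s) (r - s).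
  by rewrite dotvBl !dotvBr !dotvv r1 s1 (dotvC s r); ring.
rewrite -(subr_gt0 (dotv w s)) -dotvBr.
have : 0 < dotv z (r - s) by rewrite dotvBr subr_gt0.
move: (r - s) => m zm h; rewrite ltNge; apply/negP => wm.
have m0 : 0 < norm2 m.
  rewrite lt_neqAle eq_sym norm2_ge0 andbT; apply/eqP => /norm2_eq0 m0.
  by move: zm; rewrite m0 -(scale0r (0 : 'rV[R]_n)) dotvZr mul0r ltxx.
have mm0 : 0 < dotv m m by rewrite dotvv exprn_gt0.
pose p := z - (dotv z m / dotv m m) *: m.
have pp : norm2 p ^+ 2 = 1 - dotv z m ^+ 2 / dotv m m.
  rewrite -dotvv dotvBl !dotvBr !dotvZl !dotvZr (dotvC m z) dotvv z1.
  by field; rewrite gt_eqF.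
move: h; rewrite -pp sqrtr_sqr ger0_norm ?norm2_ge0// ltNge => /negP; apply.
have wp := cauchy_schwarz w p; rewrite w1 mul1r in wp.
(* [p] arises from [z] by removing a nonnegative multiple of [m], and [dotv w m <= 0], so
   [dotv w z <= dotv w p]. *)
apply: le_trans (le_trans (ler_norm _) wp).
rewrite dotvBr dotvZr lerBrDl gerDr.
by rewrite mulr_ge0_le0// divr_ge0// ltW.
Qed.

Lemma argmax_set1P K (s : 'I_K -> R) (y : 'I_K) :
  argmax s = [set y] <-> forall k, k != y -> s k < s y.
Proof.
split=> [sy k ky|sy].
  have ys : argmax s y by rewrite sy.
  rewrite lt_neqAle ys andbT; apply/negP => /eqP sky.
  have : argmax s k by move=> l; rewrite sky.
  by rewrite sy => /eqP; exact/negP.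
apply/seteqP; split => [k sk|_ -> k] /=.
  apply/eqP/negPn/negP => /sy; rewrite ltNge => /negP; apply; exact: sk.
by have [->|/sy/ltW] := eqVneq k y.
Qed.

End euclidean.

Section unit_expectation.
Context d (T : measurableType d) (R : realType) (P : probability T R).
Context (m : nat) (F : T -> 'rV[R]_m).
Context (mF : measurable_fun [set: T] F) (F1 : forall t, norm2 (F t) = 1).

Let integrable_bounded (f : T -> R) (M : R) : measurable_fun [set: T] f ->
  (forall t, `|f t| <= M) -> P.-integrable [set: T] (EFin \o f).
Proof.
move=> mf fM; apply: measurable_bounded_integrable => //.
  by rewrite (le_lt_trans (probability_le1 _ _)) ?ltry.
exists M; split; first exact: num_real.
by move=> N MN t _; apply: le_trans (fM t) _; exact: ltW.
Qed.

Lemma integrable_dotv (w : 'rV[R]_m) :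
  P.-integrable [set: T] (EFin \o (fun t => dotv (F t) w)).
Proof.
apply: (@integrable_bounded _ (norm2 w)); first exact: measurable_dotv.
by move=> t; rewrite (le_trans (cauchy_schwarz _ _))// F1 mul1r.
Qed.

Let integrable_coord (j : 'I_m) : P.-integrable [set: T] (EFin \o (fun t => F t 0 j)).
Proof.
apply: (@integrable_bounded _ 1); first by move/measurable_fun_matrixP : mF.
move=> t; rewrite -(ler_pXn2r (n := 2))// ?nnegrE// real_normK ?num_real//.
by rewrite -(F1 t) norm2_sqr (bigD1 j)//= lerDl sumr_ge0// => i _; exact: sqr_ge0.
Qed.

Lemma integral_dotv (w : 'rV[R]_m) :
  (\int[P]_t (dotv (F t) w)%:E)%E =
  (dotv (\row_j fine 'E_P[fun t => F t 0 j]) w)%:E.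
Proof.
rewrite /dotv.
under eq_integral do rewrite -sumEFin.
rewrite integral_sum//; last first.
  move=> j; under eq_fun do rewrite EFinM.
  exact: (integrableZr measurableT _ (integrable_coord j)).
rewrite -sumEFin; apply: eq_bigr => j _.
under eq_integral do rewrite EFinM.
rewrite (integralZr measurableT (integrable_coord j)) mxE unlock EFinM fineK//.
exact: (integrable_fin_num measurableT (integrable_coord j)).
Qed.

Lemma integral_half_dotv (w : 'rV[R]_m) :
  (\int[P]_t (2^-1 * (1 + dotv (F t) w))%:E)%E =
  (2^-1 * (1 + dotv (\row_j fine 'E_P[fun t => F t 0 j]) w))%:E.
Proof.
under eq_integral do rewrite EFinM EFinD.
have i1 : P.-integrable [set: T] (cst 1%E) by exact: finite_measure_integrable_cst.
rewrite integralZl//; last exact: integrableD (integrable_dotv w).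
rewrite integralD//; last exact: integrable_dotv.
by rewrite integral_dotv integral_cst//= probability_setT mule1.
Qed.

(** The norm of the mean is its product with its own direction, hence the mean of products of two
    unit vectors. *)
Lemma norm2_expectation_le1 : norm2 (\row_j fine 'E_P[fun t => F t 0 j]) <= 1.
Proof.
set v := \row_j _.
have [->//|v0] := eqVneq (norm2 v) 0.
have v_gt0 : 0 < norm2 v by rewrite lt_neqAle eq_sym v0 norm2_ge0.
have -> : norm2 v = dotv v (normalize2 v).
  by rewrite dotvZr dotvv expr2 mulKf.
rewrite -lee_fin -integral_dotv.
rewrite [leRHS](_ : _ = \int[P]_t (cst 1%E t))%E; last first.
  by rewrite integral_cst//= probability_setT mule1.
apply: le_integral => //; [exact: integrable_dotv|exact: finite_measure_integrable_cst|].
move=> t _; rewrite lee_fin.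
by have /andP[] := dotv_unit_bounds (F1 t) (norm2_normalize2 v_gt0).
Qed.

End unit_expectation.

(** * From the robustness score to the angle of the smoothed feature, and to retrieval *)

Section certificate.
Context {R : realType}.

Lemma Phi_inv_ex (p : R) : 0 < p < 1 -> exists2 a, Phi_inv p = a%:E & Phi a = p.
Proof.
move=> p01; have [a ap] := Phi_surj p01.
move: (p01) => /andP[p0 p1]; rewrite /Phi_inv gt_eqF// lt_eqF//.
exists (xget 0 [set r | Phi r = p]) => //.
exact: (@xgetPex _ 0 [set r | Phi r = p] (ex_intro _ a ap)).
Qed.

(** Replaces a possibly infinite [Phi_inv p] by a real threshold [a]; [Phi a <= p], rather than
    equality, is what survives when [p = 1]. *)
Lemma radius_threshold (p q N : R) : 0 <= p <= 1 -> 0 < q < 1 ->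
  (N%:E < Phi_inv p - Phi_inv q)%E ->
  exists2 a, Phi a <= p & q < Phi (a - N).
Proof.
move=> /andP[]; rewrite le_eqVlt => /predU1P[<- _|p0 p1] q01.
  (* For [p = 0] the difference is [-oo], which contradicts the strict bound. *)
  by have [b -> _] := Phi_inv_ex q01; rewrite {1}/Phi_inv eqxx.
have [b -> <-] := Phi_inv_ex q01.
move: p1; rewrite le_eqVlt => /predU1P[->|p1].
  (* For [p = 1] any [a] above [b + N] will do. *)
  move=> _; exists (b + N + 1); first exact: Phi_le1.
  by apply: Phi_lt; lra.
have [a -> <-] : exists2 a, Phi_inv p = a%:E & Phi a = p by apply: Phi_inv_ex; rewrite p0.
by rewrite -EFinB lte_fin => Nab; exists a => //; apply: Phi_lt; lra.
Qed.

Context (d m : nat) (fe : 'rV[R]_d -> 'rV[R]_m).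
Context (mfe : measurable_fun [set: 'rV[R]_d] fe).
Context (fe_unit : forall u, norm2 (fe u) = 1).

Let measurable_fe_shift x : measurable_fun [set: 'rV[R]_d] (fun v => fe (x + v)).
Proof.
under eq_fun do rewrite addrC.
exact: (measurableT_comp mfe (measurable_addr_rV x)).
Qed.

(** Between unit vectors [Cos] is the scalar product, whose linearity lets the expectation move
    inside. *)
Lemma robustness_scoreE x :
  robustness_score fe x = 2^-1 * (1 + dotv (smoothed fe x) (fe x)).
Proof.
congr (_ * (1 + _)).
rewrite -[RHS]/(fine (dotv (smoothed fe x) (fe x))%:E).
rewrite -(integral_dotv (std_gaussian d) (measurable_fe_shift x) (fun v => fe_unit _)).
rewrite unlock; congr fine; apply: eq_integral => v _.
by rewrite /Cos !fe_unit mulr1 divr1.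
Qed.

Lemma norm2_smoothed_le1 x : norm2 (smoothed fe x) <= 1.
Proof.
exact: (norm2_expectation_le1 (std_gaussian d) (measurable_fe_shift x) (fun v => fe_unit _)).
Qed.

Lemma smoothed_angle (x x' : 'rV[R]_d) (c : R) : 0 <= c < 1 ->
  ((norm2 (x' - x))%:E <
    Phi_inv (robustness_score fe x) - Phi_inv ((1 + c) / 2))%E ->
  c < dotv (smoothed fe x') (fe x).
Proof.
move=> c01; set z := fe x => near_x.
pose g v := 2^-1 * (1 + dotv (fe (x + v)) z).
have g01 v : 0 <= g v <= 1.
  by have := dotv_unit_bounds (fe_unit (x + v)) (fe_unit x); rewrite /g -/z; lra.
have mg : measurable_fun [set: 'rV[R]_d] g.
  apply: measurable_funM => //; apply: measurable_funD => //.
  exact: measurable_dotv.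
have Ig : (\int[std_gaussian d]_v (g v)%:E)%E = (robustness_score fe x)%:E.
  rewrite robustness_scoreE.
  exact: (integral_half_dotv (std_gaussian d) (measurable_fe_shift x) (fun v => fe_unit _)).
have S01 : 0 <= robustness_score fe x <= 1.
  rewrite -!lee_fin -Ig integral_ge0//=; last first.
    by move=> v _; rewrite lee_fin; case/andP: (g01 v).
  rewrite [leRHS](_ : _ = \int[std_gaussian d]_v (cst 1%E v))%E; last first.
    by rewrite integral_cst//= [X in (_ * X)%E]probability_setT mule1.
  apply: ge0_le_integral => //.
  - by move=> v _; rewrite lee_fin; case/andP: (g01 v).
  - exact/measurable_EFinP.
  - by move=> v _; rewrite lee_fin; case/andP: (g01 v).
(* The bounds on [c] put [(1 + c) / 2] strictly between 0 and 1. *)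
have [] := radius_threshold S01 _ near_x; first by lra.
move=> a aS cN.
have := @le_integral_std_gaussian_shift R d (x' - x) g a mg g01.
rewrite Ig lee_fin => /(_ aS).
have -> : (\int[std_gaussian d]_v (g (v + (x' - x)))%:E)%E =
    (2^-1 * (1 + dotv (smoothed fe x') z))%:E.
  rewrite -(integral_half_dotv (std_gaussian d) (measurable_fe_shift x') (fun v => fe_unit _)).
  apply: eq_integral => v _; rewrite /g; congr (_ * (1 + dotv (fe _) _))%:E.
  (* Shifting the noise by [x' - x] recentres it from [x] to [x']. *)
  by rewrite addrCA subrKC addrC.
by rewrite lee_fin => /(lt_le_trans cN); lra.
Qed.

End certificate.

Theorem corollary4p1 (R : realType) (d m : nat) (fe : 'rV[R]_d -> 'rV[R]_m)
    (mfe : measurable_fun [set: 'rV[R]_d] fe)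
    (fe_unit : forall u, norm2 (fe u) = 1)
    (K : nat) (K_ge2 : (2 <= K)%N)
    (t : 'I_K -> 'rV[R]_m) (t_unit : forall k, norm2 (t k) = 1)
    (x : 'rV[R]_d) (y : 'I_K)
    (y_argmax : argmax (fun k => dotv (fe x) (t k)) = [set y])
    (x' : 'rV[R]_d)
    (x'_near : ((norm2 (x' - x))%:E < radius_ret fe t x y)%E) :
  argmax (fun k => dotv (normalize2 (smoothed fe x')) (t k)) = [set y].
Proof.
set z := fe x in y_argmax; set v := smoothed fe x'.
have /argmax_set1P y_lt := y_argmax.
have gamma_lt1 k : k != y -> gamma t z y k < 1.
  move=> /y_lt; rewrite -subr_gt0 /gamma; set s := _ - _ => s0.
  have /andP[_] := dotv_unit_bounds (t_unit y) (t_unit k).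
  (* If [dotv (t y) (t k) = 1], the denominator in [gamma] vanishes; but then the unit vectors [t y]
     and [t k] coincide, against the strict gap [s0]. *)
  rewrite le_eqVlt => /predU1P[tyk|tyk].
    have ts : norm2 (t y - t k) = 0.
      apply/eqP; rewrite -sqrf_eq0 -dotvv dotvBl !dotvBr !dotvv !t_unit.
      by rewrite (dotvC (t k)) tyk !expr1n !subrr.
    have /subr0_eq tE := norm2_eq0 ts.
    by move: s0; rewrite /s tE subrr ltxx.
  rewrite -[ltRHS]sqrtr1 ltr_sqrt// gtrBl divr_gt0 ?exprn_gt0//.
  by rewrite mulr_gt0// subr_gt0.
set c := gamma_top1 t z y.
have c0 : 0 <= c by exact: bigmax_ge_id.
(* The default value 0 of the maximum must be below 1 as well. *)
have c1 : c < 1 by apply/bigmax_ltP; split => // k ky; exact: gamma_lt1.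
have cv : c < dotv v z.
  by apply: smoothed_angle => //; rewrite c0.
(* The normalization is meaningful: a zero [v] would give [dotv v z = 0 <= c]. *)
have v0 : 0 < norm2 v.
  rewrite lt_neqAle eq_sym norm2_ge0 andbT; apply/eqP => /norm2_eq0 vE.
  move: (le_lt_trans c0 cv); rewrite vE -(scale0r (0 : 'rV[R]_m)) dotvZl mul0r.
  by rewrite ltxx.
(* Dividing a nonnegative scalar product by a norm in []0, 1]] cannot decrease it. *)
have cw : c < dotv (normalize2 v) z.
  apply: (lt_le_trans cv); rewrite dotvZl ler_peMl//.
    exact: ltW (le_lt_trans c0 cv).
  by rewrite invf_ge1// norm2_smoothed_le1.
apply/argmax_set1P => k ky.
apply: (dotv_lt_of_angle (norm2_normalize2 v0) (fe_unit x)) => //; first exact: y_lt.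
apply: le_lt_trans cw.
exact: (@le_bigmax_cond _ _ _ _ _ (fun k => k != y) (gamma t z y)).
Qed.
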